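(* Let $A=(a_{ij}), B=(b_{ij}) \in \mathbb{R}^{n\times n}$ satisfy $$|a_{ii}| > \sum_{j=1}^{n} |b_{ij}| + \sum_{j\neq i} |a_{ij}| \quad \text{for every } i \in \{1,2,\dots,n\}.$$ Then for every $b \in \mathbb{R}^n$ the generalized absolute value equation $Ax - B|x| = b$ has exactly one solution $x \in \mathbb{R}^n$.
   Context: For a vector $x \in \mathbb{R}^n$, $|x|$ denotes the vector of component-wise absolute values of $x$. *)

(* Defs.v *)
From mathcomp Require Import all_boot all_order all_algebra.
From mathcomp Require Import reals.

Set Implicit Arguments.
Unset Strict Implicit.
Unset Printing Implicit Defensive.

Import GRing.Theory Num.Theory.
Local Open Scope ring_scope.

(* The vector |x| of absolute values; the norm notation of MathComp-Analysis
   on matrices is the (scalar) sup norm and is not what is meant here. *)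
Definition absv (R : realType) (n : nat) (x : 'cV[R]_n) : 'cV[R]_n :=
  \col_i `|x i 0|.

(* Main.v *)
(* Dividing the i-th equation by a_ii turns the system into a fixed-point
   problem whose map has, for the sup norm, the Lipschitz constant
   max_i (sum_j |b_ij| + sum_(j != i) |a_ij|) / |a_ii| < 1, so Banach's theorem
   applies. *)
Require Import Defs.
From HB Require Import structures.
From mathcomp Require Import all_boot all_order all_algebra.
From mathcomp Require Import classical_sets functions.
From mathcomp Require Import interval_inference.
From mathcomp Require Import reals topology normedtype sequences.

Set Implicit Arguments.
Unset Strict Implicit.
Unset Printing Implicit Defensive.

Import Order.TTheory GRing.Theory Num.Theory.
Import numFieldNormedType.Exports.
Local Open Scope ring_scope.

(* Matrices are declared complete before they are declared normed, so their
   completeNormedModType structure is only inferred after this repetition. *)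
HB.instance Definition _ (R : realType) (m n : nat) :=
  Complete.on 'M[R]_(m, n).

Lemma normr_mx_entry_le (R : realType) m n (x : 'M[R]_(m, n)) i j :
  `|x i j| <= `|x|.
Proof.
rewrite [leRHS]/Num.Def.normr /= mx_normrE.
exact: (le_bigmax _ (fun k => `|x k.1 k.2|) (i, j)).
Qed.

(** The norm is a maximum of entries started at 0, so [0 <= e] covers matrices without entries. *)
Lemma normr_mx_le (R : realType) m n (x : 'M[R]_(m, n)) (e : R) :
  0 <= e -> (forall i j, `|x i j| <= e) -> `|x| <= e.
Proof.
move=> e0 xe; rewrite [leLHS]/Num.Def.normr /= mx_normrE.
by apply: bigmax_le => // -[i j] _; exact: xe.
Qed.

(** Banach's theorem for a closed nonempty set, applied to the whole space, which contains 0. *)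
Lemma contracting_unique_fixpoint (R : realType) (X : completeNormedModType R)
    (f : X -> X) (q : R) :
  0 <= q -> q < 1 -> (forall x y, `|f x - f y| <= q * `|x - y|) ->
  exists! x, f x = x.
Proof.
move=> q0 q1 fq.
have fT : set_fun [set: X] [set: X] f by [].
have ctr : is_contraction (mkfun fT).
  by exists (NngNum q0); split=> // -[x y] _; exact: fq.
have [||p _ fp] := banach_fixed_point ctr.
- exact: closedT.
- by exists 0.
exists p; split=> [|y fy]; first by rewrite [RHS]fp.
exact: (contraction_fixpoint_unique ctr).
Qed.

(** One Jacobi step: row [i] is solved for its diagonal unknown, with the off-diagonal terms and the
    absolute values taken at the old iterate. *)
Definition jacobi_map (R : realType) n (A B : 'M[R]_n) (b x : 'cV[R]_n) :
    'cV[R]_n :=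
  \col_i ((b i 0 + \sum_j B i j * `|x j 0| - \sum_(j | j != i) A i j * x j 0)
          / A i i).

Lemma jacobi_map_fixpoint (R : realType) n (A B : 'M[R]_n) (b x : 'cV[R]_n) :
  (forall i, A i i != 0) ->
  jacobi_map A B b x = x <-> A *m x - B *m absv x = b.
Proof.
move=> A0.
have entryE i : (A *m x - B *m absv x) i 0 =
    A i i * x i 0 + \sum_(j | j != i) A i j * x j 0 - \sum_j B i j * `|x j 0|.
  rewrite !mxE (bigD1 i) //=; congr (_ - _).
  by apply: eq_bigr => j _; rewrite mxE.
split=> [fx|bE]; apply/colP => i.
- rewrite entryE -[in A i i * _]fx mxE mulrC divfK //.
  by rewrite subrK addrK.
- by rewrite mxE -bE entryE subrK addrK mulrAC mulfV // mul1r.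
Qed.

Lemma jacobi_map_lipschitz (R : realType) n (A B : 'M[R]_n)
    (b x y : 'cV[R]_n) (q : R) : 0 <= q ->
  (forall i, (\sum_j `|B i j| + \sum_(j | j != i) `|A i j|) / `|A i i| <= q) ->
  `|jacobi_map A B b x - jacobi_map A B b y| <= q * `|x - y|.
Proof.
move=> q0 qP; apply: normr_mx_le => [|i j]; first by rewrite mulr_ge0.
have xyj k : `|x k 0 - y k 0| <= `|x - y|.
  by have := normr_mx_entry_le (x - y) k 0; rewrite !mxE.
rewrite !mxE -mulrBl normrM normfV.
(* Passing from [q] to the ratio of row [i] lets the division by [|A i i|] cancel on both sides. *)
apply: le_trans (ler_wpM2r (normr_ge0 _) (qP i)).
rewrite mulrAC ler_wpM2r ?invr_ge0 //.
set Bx := \sum_j B i j * `|x j 0|; set By := \sum_j B i j * `|y j 0|.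
set Ax := \sum_(j | j != i) A i j * x j 0.
set Ay := \sum_(j | j != i) A i j * y j 0.
have -> : b i 0 + Bx - Ax - (b i 0 + By - Ay) = (Bx - By) - (Ax - Ay).
  rewrite -(addrA _ Bx) -(addrA _ By) opprD addrACA subrr add0r.
  by rewrite !opprD addrACA.
rewrite (le_trans (ler_normB _ _)) // mulrDl /Bx /By /Ax /Ay -!sumrB !mulr_suml.
apply: lerD; apply: le_trans (ler_norm_sum _ _ _) _; apply: ler_sum => k _;
  rewrite -mulrBr normrM ler_wpM2l //.
(* Only the [B] terms remain: by the reverse triangle inequality, absolute values do not increase
   distances. *)
exact: le_trans (ler_dist_dist _ _) (xyj k).
Qed.

Theorem theorem2 (R : realType) (n : nat) (A B : 'M[R]_n)
    (hAB : forall i : 'I_n,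
       `|A i i| > \sum_(j < n) `|B i j| + \sum_(j < n | j != i) `|A i j|) :
  forall b : 'cV[R]_n,
    exists! x : 'cV[R]_n, A *m x - B *m absv x = b.
Proof.
move=> b.
have s_ge0 i : 0 <= \sum_(j < n) `|B i j| + \sum_(j < n | j != i) `|A i j|.
  by rewrite addr_ge0 // sumr_ge0.
have Aii_gt0 i : 0 < `|A i i| by exact: le_lt_trans (hAB i).
have A0 i : A i i != 0 by rewrite -normr_gt0.
pose c i := (\sum_j `|B i j| + \sum_(j | j != i) `|A i j|) / `|A i i|.
(* The default value 0 gives [0 <= q], and also [q < 1] when [n = 0]; otherwise [q < 1] holds
   because a maximum of finitely many ratios below 1 is below 1. *)
pose q := \big[Num.max/0]_i c i.
have q_ge0 : 0 <= q by exact: bigmax_ge_id.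
have q_lt1 : q < 1.
  by apply: bigmax_lt => // i _; rewrite /c ltr_pdivrMr // mul1r.
have cq i : c i <= q by exact: le_bigmax.
have [x [fx ux]] := contracting_unique_fixpoint q_ge0 q_lt1
  (fun x y => jacobi_map_lipschitz b x y q_ge0 cq).
exists x; split=> [|y yb]; first exact/jacobi_map_fixpoint.
by apply: ux; exact/jacobi_map_fixpoint.
Qed.
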